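(* Let $p$ be a prime and $3\le k\le p$. Let $(X_1,\dots,X_k)$ have the uniform distribution over arithmetic progressions of length $k$ in $\mathbb{Z}_p^n$, and let $Y_1,\dots,Y_k$ be i.i.d. uniformly distributed in $\mathbb{Z}_p^n$. Let $d\ge0$ be an integer, let $f_1,\dots,f_k:\mathbb{Z}_p^n\to\mathbb{C}$ have Fourier degree at most $d$ and satisfy $\|f_i\|_2\le 1$ for all $i$, and let $\epsilon>0$. If $$\bigl|\mathbb{E}[f_1(X_1)\cdots f_k(X_k)]-\mathbb{E}[f_1(Y_1)\cdots f_k(Y_k)]\bigr|>\epsilon,$$ then, with respect to the standard Fourier basis: (1) none of the functions $f_i$ is $\delta$-uniform with $$\delta=\frac{\epsilon}{(k\sqrt{p-1})^{3dk}};$$ (2) there exist indices $1\le i(1)<i(2)<i(3)\le k$ and multi-indices $\sigma(1),\sigma(2),\sigma(3)\in\mathbb{Z}_p^n$ with $S(\sigma(1))\cap S(\sigma(2))\cap S(\sigma(3))\ne\emptyset$ such that $$|\widehat{f_{i(j)}}(\sigma(j))|\ge\left(\frac{\epsilon}{k\cdot(k\sqrt{p-1})^{3dk}}\right)^{2^k}\qquad\text{for } 1\le j\le 3.$$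
   Context: Uniform distribution over arithmetic progressions of length $k$: $X_i=iX+Y$ for $i=1,\dots,k$, where $X,Y$ are independent and uniform in $\mathbb{Z}_p^n$. $\mathbb{Z}_p^n$ carries the uniform probability measure; $\|f\|_2=(\mathbb{E}|f|^2)^{1/2}$ with respect to it. Standard Fourier basis: $\chi_\sigma(x)=\exp\left(2\pi i\sum_{j=1}^n\sigma_jx_j/p\right)$ for $\sigma\in\mathbb{Z}_p^n$, and $\hat f(\sigma)=\mathbb{E}[f\,\overline{\chi_\sigma}]$. The support of a multi-index $\sigma$ is $S(\sigma)=\{j\in\{1,\dots,n\}:\sigma_j\ne0\}$. $f$ has Fourier degree at most $d$ if $\hat f(\sigma)=0$ whenever $|S(\sigma)|>d$. $f$ is $\delta$-uniform if $|\hat f(\sigma)|\le\delta$ for all $\sigma\in\mathbb{Z}_p^n$. *)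

(* Defs.v *)
From mathcomp Require Import all_boot all_order all_algebra.
From mathcomp Require Import complex reals trigo.

Set Implicit Arguments.
Unset Strict Implicit.
Unset Printing Implicit Defensive.

Import Order.TTheory GRing.Theory Num.Theory.

Local Open Scope ring_scope.
Local Open Scope complex_scope.

(* The modulus as a real number; the norm [`|z|] of R[i] is R[i]-valued. *)
Notation cabs := ComplexField.Normc.normc.

(* 'F_p is Z/pZ only for p prime, which is assumed where this type is used. *)
Notation Zpn p n := 'rV['F_p]_n.

Definition expect (K : numFieldType) (T : finType) (g : T -> K) : K :=
  (\sum_(t : T) g t) / #|T|%:R.

Section Fourier.
Variables (R : realType) (p n : nat).
Implicit Types (f : Zpn p n -> R[i]) (s x : Zpn p n).

Definition expi (t : R) : R[i] := cos t +i* sin t.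

(* The sum is computed in nat on the representatives in {0, ..., p - 1} of the
   coordinates; the value only depends on it modulo p. *)
Definition chi s x : R[i] :=
  expi (2 * pi * (\sum_(j < n) (s 0%R j : nat) * (x 0%R j : nat))%N%:R / p%:R).

Definition fourier f s : R[i] := expect (fun x => f x * (chi s x)^*).

Definition supp s : {set 'I_n} := [set j | s 0 j != 0].

Definition fourier_degree_le (d : nat) f : Prop :=
  forall s, (d < #|supp s|)%N -> fourier f s = 0.

Definition delta_uniform (delta : R) f : Prop :=
  forall s, cabs (fourier f s) <= delta.

Definition norm2 f : R := Num.sqrt (expect (fun x => cabs (f x) ^+ 2)).

(* E[f_1(X_1) ... f_k(X_k)] with X_i = i X + Y, where (X, Y) is uniform on
   Zpn * Zpn; the index i in {1, ..., k} is represented by i - 1 : 'I_k. *)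
Definition expect_ap (k : nat) (f : 'I_k -> Zpn p n -> R[i]) : R[i] :=
  expect (fun xy : Zpn p n * Zpn p n =>
    \prod_(i < k) f i (xy.1 *+ i.+1 + xy.2)).

(* E[f_1(Y_1) ... f_k(Y_k)] with (Y_1, ..., Y_k) uniform on (Zpn)^k. *)
Definition expect_iid (k : nat) (f : 'I_k -> Zpn p n -> R[i]) : R[i] :=
  expect (fun y : {ffun 'I_k -> Zpn p n} => \prod_(i < k) f i (y i)).

End Fourier.

(* Main.v *)
(* Writing b_i for |hat f_i|, the difference of the two expectations is bounded by
   the sum of prod_i b_i(g_i) over the nonzero tuples g satisfying
   sum_i g_i = 0 and sum_i i g_i = 0.  In such a tuple, a coordinate at which some
   g_i is nonzero is one at which at least three are.  If b_{i0} <= delta, take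
   delta out and set g_{i0} = 0: every coordinate then has a number of nonzero
   entries different from 1.  The sum over all tuples with this last property
   satisfies a hypercontractive bound: for each coordinate,
   [j <> 1] <= E[theta^j] with theta = 2 or -1 of mean zero, which makes the
   one-coordinate sum a combination of two products, and the bound tensorizes.
   This gives (1).  For (2), let tau = eps / (k M): if every nonzero tuple had some
   b_i(g_i) < tau, the same bound would give at most k tau M = eps; so some tuple
   has all b_i(g_i) >= tau, and a coordinate where three of its entries are nonzero
   gives the three indices. *)
Require Import Defs.
From mathcomp Require Import all_boot all_order all_algebra.
From mathcomp Require Import complex reals trigo.
From mathcomp Require Import ring lra.

Set Implicit Arguments.
Unset Strict Implicit.
Unset Printing Implicit Defensive.

Import Order.TTheory GRing.Theory Num.Theory.

Local Open Scope ring_scope.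
Local Open Scope complex_scope.

(** * One-coordinate moment inequality *)

(** For theta equal to 2 or -1, theta^2 = theta + 2. Hence multiplying [F + theta G] by
    [x + theta y] gives the two expressions squared on the left as constant term and coefficient of
    theta. *)
Lemma sqr_moment_step (R : realFieldType) (F G x y c q : R) :
  0 <= c -> 2 * c + 2 * (2 + c) ^+ 2 <= q ->
  (x * F + 2 * y * G) ^+ 2 + c * (x * G + y * (F + G)) ^+ 2
    <= (F ^+ 2 + (c + 1) * G ^+ 2) * (x ^+ 2 + q * y ^+ 2).
Proof.
move=> c0 hq; rewrite -subr_ge0.
(* Lowering the weight of [G ^+ 2] from [c + 1] to [c] leaves [x ^+ 2 * G ^+ 2], which completes a
   square with the cross terms in [x * y]; a large [q] makes the rest nonnegative. *)
have -> : (F ^+ 2 + (c + 1) * G ^+ 2) * (x ^+ 2 + q * y ^+ 2)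
    - ((x * F + 2 * y * G) ^+ 2 + c * (x * G + y * (F + G)) ^+ 2) =
  (x * G - y * ((2 + c) * F + c * G)) ^+ 2
  + y ^+ 2 * (((2 + c) * F - c * G) ^+ 2 + c * (F - G) ^+ 2
     + (q - (2 * c + 2 * (2 + c) ^+ 2)) * F ^+ 2
     + ((c + 1) * q - (4 + 2 * c + 2 * c ^+ 2)) * G ^+ 2) by ring.
have h1 : 0 <= (c + 1) * q - (4 + 2 * c + 2 * c ^+ 2) by nra.
have h2 : 0 <= q - (2 * c + 2 * (2 + c) ^+ 2) by rewrite subr_ge0.
rewrite addr_ge0 ?sqr_ge0 // mulr_ge0 ?sqr_ge0 //.
by rewrite !addr_ge0 // ?sqr_ge0 // mulr_ge0 ?sqr_ge0.
Qed.

(* The bound on [F ^+ 2] is the goal; the term in [G], whose coefficient decreases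
   along the induction, is what makes the induction work. *)
Lemma sqr_moment_prod (R : realFieldType) (I : Type) (x y : I -> R) (r : seq I)
    (k : nat) (q : R) (A := fun r => \prod_(i <- r) (x i + 2 * y i))
    (B := fun r => \prod_(i <- r) (x i - y i))
    (F := fun r => (A r + 2 * B r) / 3) (G := fun r => (A r - B r) / 3) :
  2 * k%:R + 2 * (2 + k%:R) ^+ 2 <= q -> (size r <= k)%N ->
  F r ^+ 2 + (k - size r)%:R * G r ^+ 2
    <= \prod_(i <- r) (x i ^+ 2 + q * y i ^+ 2).
Proof.
move=> hq; elim: r => [_|i r IHr /= hr].
  by rewrite /F /G /A /B /= !big_nil; lra.
have := IHr (ltnW hr).
set c : R := (k - (size r).+1)%:R.
have -> : (k - size r)%:R = c + 1 by rewrite /c natr1 subnSK.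
have hc0 : 0 <= c by [].
have hc : 2 * c + 2 * (2 + c) ^+ 2 <= q.
  have : c <= k%:R by rewrite ler_nat leq_subr.
  by nra.
move=> IH; rewrite [leRHS]big_cons [leRHS]mulrC.
(* [F + 2 G] is [A] and [F - G] is [B], so [F + theta G] is the product at theta for both values. *)
have -> : F (i :: r) = x i * F r + 2 * y i * G r.
  by rewrite /F /G /A /B !big_cons; field.
have -> : G (i :: r) = x i * G r + y i * (F r + G r).
  by rewrite /F /G /A /B !big_cons; field.
apply: le_trans (sqr_moment_step _ _ _ _ hc0 hc) _.
apply: ler_wpM2r => //.
have : 0 <= q by nra.
by move=> q0; rewrite addr_ge0 ?sqr_ge0 // mulr_ge0 ?sqr_ge0.
Qed.

(* For a random variable worth 2 with probability 1/3 and -1 with probability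
   2/3, the first moment is 0 and all others are at least 1. *)
Lemma neq1_le_moment (R : realFieldType) (j : nat) :
  (j != 1)%:R <= (2 ^+ j + 2 * (-1) ^+ j) / 3 :> R.
Proof.
case: j => [|[|[|j]]]; rewrite ?expr0 ?expr1 ?sqrrN ?expr1n /=; [lra|lra|lra|].
have : 8 <= 2 ^+ j.+3 :> R.
  by rewrite -natrX ler_nat -[8%N]/(2 ^ 3)%N leq_exp2l.
rewrite mulr1n -signr_odd; move: (2 ^+ j.+3) => u.
by case: odd; rewrite ?expr0 ?expr1; lra.
Qed.

(** Cauchy-Schwarz against the constant 1, read off the nonnegative double sum of
    [(F i - F j) ^+ 2]. *)
Lemma sqr_sum_le (R : realFieldType) (I : finType) (P : pred I) (F : I -> R) :
  (\sum_(i | P i) F i) ^+ 2 <= #|P|%:R * \sum_(i | P i) F i ^+ 2.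
Proof.
set S := \sum_(i | P i) F i; set S2 := \sum_(i | P i) F i ^+ 2.
have : 0 <= \sum_(i | P i) \sum_(j | P j) (F i - F j) ^+ 2.
  by apply: sumr_ge0 => i _; apply: sumr_ge0 => j _; apply: sqr_ge0.
have -> : \sum_(i | P i) \sum_(j | P j) (F i - F j) ^+ 2 =
    2 * (#|P|%:R * S2 - S ^+ 2).
  transitivity (\sum_(i | P i) (#|P|%:R * F i ^+ 2 - 2 * (F i * S) + S2)).
    apply: eq_bigr => i _.
    rewrite /S mulr_sumr mulr_sumr mulr_natl -sumr_const -sumrB -big_split /=.
    by apply: eq_bigr => j _; ring.
  rewrite big_split sumrB /= -!mulr_sumr -mulr_suml sumr_const -/S -/S2 -mulr_natl.
  by ring.
by lra.
Qed.

(** * Multilinear bounds over tuples and their tensorization *)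

(** Weighted l2 boundedness of the multilinear form whose kernel is the indicator of [K], in squared
    form; this shape is stable under products. *)
Definition multilinear_bound (R : realFieldType) (T : finType) (k : nat)
    (K : pred {ffun 'I_k -> T}) (w : T -> R) : Prop :=
  forall a : 'I_k -> T -> R, (forall i t, 0 <= a i t) ->
    (\sum_(g | K g) \prod_(i < k) a i (g i)) ^+ 2
      <= \prod_(i < k) \sum_t w t * a i t ^+ 2.

(** After the indicator is replaced by a mean of powers of theta, the sum over tuples factors for
    each theta into [x i + theta * y i], where [x i] is the value at 0 and [y i] the mass off 0.
    Cauchy-Schwarz over the nonzero elements bounds [y i ^+ 2]. *)
Lemma multilinear_bound_coord (R : realFieldType) (A : finZmodType) (k : nat)
    (q : R) :
  2 * k%:R + 2 * (2 + k%:R) ^+ 2 <= q ->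
  multilinear_bound (fun g : {ffun 'I_k -> A} => #|[set i | g i != 0%R]| != 1)
    (fun t => (q * (#|A|%:R - 1)) ^+ (t != 0)).
Proof.
move=> hq a a0.
have q0 : 0 <= q by have := ler0n R k; nra.
pose x i := a i 0; pose y i := \sum_(t | t != 0) a i t.
have theta_sum (theta : R) :
    \sum_(g : {ffun 'I_k -> A}) theta ^+ #|[set i | g i != 0]|
      * \prod_(i < k) a i (g i) = \prod_(i < k) (x i + theta * y i).
  transitivity (\prod_(i < k) \sum_t theta ^+ (t != 0) * a i t).
    rewrite bigA_distr_bigA; apply: eq_bigr => g _.
    rewrite big_split /=; congr (_ * _).
    rewrite -prodr_const [RHS](eq_bigr (fun i => if g i != 0 then theta else 1)).
      by rewrite -big_mkcond; apply: eq_bigl => i; rewrite inE.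
    by move=> i _; case: eqP.
  apply: eq_bigr => i _; rewrite (bigD1 0) //= eqxx expr0 mul1r.
  by rewrite mulr_sumr; congr (_ + _); apply: eq_bigr => t ->.
have card_n0 : #|[pred t : A | t != 0]|%:R = #|A|%:R - 1 :> R.
  rewrite (cardD1 (0 : A) A) !inE natrD addrAC subrr add0r; congr (_%:R).
  by apply: eq_card => t; rewrite !inE andbT.
have prod_ge0 (g : {ffun 'I_k -> A}) : 0 <= \prod_(i < k) a i (g i).
  by apply: prodr_ge0.
set S := \sum_(g | _) _.
have S0 : 0 <= S by apply: sumr_ge0.
have le1 : S <= (\prod_(i < k) (x i + 2 * y i) + 2 * \prod_(i < k) (x i - y i)) / 3.
  have -> : \prod_(i < k) (x i - y i) = \prod_(i < k) (x i + (-1) * y i).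
    by apply: eq_bigr => i _; rewrite mulN1r.
  rewrite -!theta_sum mulr_sumr -big_split mulr_suml /S big_mkcond /=.
  apply: ler_sum => g _; set m := #|_|.
  have := ler_wpM2r (prod_ge0 g) (neq1_le_moment R m).
  case: (m != 1); rewrite ?mul1r ?mul0r => h; apply: le_trans h _; lra.
have le2 :
  ((\prod_(i < k) (x i + 2 * y i) + 2 * \prod_(i < k) (x i - y i)) / 3) ^+ 2
    <= \prod_(i < k) (x i ^+ 2 + q * y i ^+ 2).
  (* The full index list has length [k], so the weight of [G ^+ 2] is 0 and only [F ^+ 2] is
     left. *)
  have := @sqr_moment_prod R _ x y (index_enum 'I_k) k q hq.
  have -> : size (index_enum 'I_k) = k by rewrite /index_enum -enumT size_enum_ord.
  by rewrite leqnn subnn mul0r addr0; apply.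
apply: le_trans (le_trans le2 _).
  by apply: lerXn2r => //; rewrite ?nnegrE //; apply: le_trans le1.
apply: ler_prod => i _; rewrite addr_ge0 ?sqr_ge0 ?(mulr_ge0 q0) ?sqr_ge0 //=.
rewrite (bigD1 0) //= eqxx expr0 mul1r lerD2l.
rewrite (eq_bigr (fun t => q * (#|A|%:R - 1) * a i t ^+ 2)); last by move=> t ->.
rewrite -mulr_sumr -mulrA ler_wpM2l //.
by rewrite -card_n0; apply: sqr_sum_le.
Qed.
(** For fixed first components, the bound for [K'] controls the sum over second components by the
    product of the slice norms [b i (g i)]; the bound for [K] is then applied to [b]. *)
Lemma multilinear_bound_prod (R : rcfType) (T T' : finType) (k : nat)
    (K : pred {ffun 'I_k -> T}) (K' : pred {ffun 'I_k -> T'})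
    (w : T -> R) (w' : T' -> R) :
  (forall t, 0 <= w' t) ->
  multilinear_bound K w -> multilinear_bound K' w' ->
  multilinear_bound
    (fun g : {ffun 'I_k -> T * T'} => K [ffun i => (g i).1] && K' [ffun i => (g i).2])
    (fun t => w t.1 * w' t.2).
Proof.
move=> w'0 hK hK' a a0.
pose b i t := Num.sqrt (\sum_t' w' t' * a i (t, t') ^+ 2).
have b0 i t : 0 <= b i t by apply: sqrtr_ge0.
have b2 i t : b i t ^+ 2 = \sum_t' w' t' * a i (t, t') ^+ 2.
  by rewrite sqr_sqrtr //; apply: sumr_ge0 => t' _; rewrite mulr_ge0 ?sqr_ge0.
have -> : \prod_(i < k) \sum_t w t.1 * w' t.2 * a i t ^+ 2 =
    \prod_(i < k) \sum_t w t * b i t ^+ 2.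
  apply: eq_bigr => i _.
  under [RHS]eq_bigr do rewrite b2 mulr_sumr.
  rewrite pair_bigA /=; apply: eq_bigr => -[t t'] _ /=; exact/esym/mulrA.
apply: le_trans (hK b b0).
rewrite lerXn2r ?nnegrE ?sumr_ge0 // => [g _|g _|]; do ?exact: prodr_ge0.
have -> : \sum_(g : {ffun 'I_k -> T * T'}
        | K [ffun i => (g i).1] && K' [ffun i => (g i).2])
      \prod_(i < k) a i (g i) =
    \sum_(g | K g) \sum_(g' | K' g') \prod_(i < k) a i (g i, g' i).
  rewrite pair_big /=.
  rewrite (reindex (fun u : {ffun 'I_k -> T} * {ffun 'I_k -> T'} =>
    [ffun i => (u.1 i, u.2 i)])) /=.
    apply: eq_big => [[g g']|[g g'] _] /=.
      by congr (K _ && K' _); apply/ffunP => i; rewrite !ffunE.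
    by apply: eq_bigr => i _; rewrite ffunE.
  apply: onW_bij; exists (fun g : {ffun 'I_k -> T * T'} =>
    ([ffun i => (g i).1] : {ffun 'I_k -> T}, [ffun i => (g i).2] : {ffun 'I_k -> T'})).
    by case=> g g'; congr pair; apply/ffunP => i; rewrite !ffunE.
  by move=> g; apply/ffunP => i; rewrite !ffunE; case: (g i).
apply: ler_sum => g _.
rewrite -(@ler_pXn2r _ 2) ?nnegrE //; last 2 first.
- by apply: sumr_ge0 => g' _; apply: prodr_ge0.
- exact: prodr_ge0.
rewrite -prodrXl; under [leRHS]eq_bigr do rewrite b2.
exact: hK'.
Qed.

Lemma multilinear_bound_reindex (R : realFieldType) (T T' : finType) (k : nat)
    (h : T' -> T) (K : pred {ffun 'I_k -> T}) (w : T -> R) :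
  bijective h -> multilinear_bound K w ->
  multilinear_bound (fun g : {ffun 'I_k -> T'} => K [ffun i => h (g i)])
    (fun t => w (h t)).
Proof.
case=> h' hK h'K bound a a0.
have := bound (fun i t => a i (h' t)) (fun i t => a0 i (h' t)).
rewrite (reindex (fun g : {ffun 'I_k -> T'} => [ffun i => h (g i)])) /=; last first.
  apply: onW_bij; exists (fun g : {ffun 'I_k -> T} => [ffun i => h' (g i)]) => g;
    by apply/ffunP => i; rewrite !ffunE ?hK ?h'K.
under eq_bigr do under eq_bigr do rewrite ffunE hK.
move=> /le_trans; apply; rewrite le_eqVlt; apply/predU1P; left.
apply: eq_bigr => i _; rewrite (reindex h) /=; last by apply: onW_bij; exists h'.
by apply: eq_bigr => t _; rewrite hK.
Qed.

(** Induction on [n]: a row splits into its first entry and the others, and both the condition and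
    the weight are products over coordinates. *)
Lemma multilinear_bound_row (R : rcfType) (A : finZmodType) (k n : nat)
    (q : R) (Q := q * (#|A|%:R - 1)) :
  2 * k%:R + 2 * (2 + k%:R) ^+ 2 <= q ->
  multilinear_bound
    (fun g : {ffun 'I_k -> 'rV[A]_n} =>
       \big[andb/true]_(j < n) (#|[set i | g i 0 j != 0]| != 1))
    (fun t => \prod_(j < n) Q ^+ (t 0 j != 0)).
Proof.
move=> hq.
have Q0 : 0 <= Q.
  rewrite mulr_ge0 //; first by have := ler0n R k; nra.
  by rewrite subr_ge0 ler1n; apply/card_gt0P; exists 0.
elim: n => [|n IHn].
  move=> a a0; rewrite (big_pred1 [ffun=> 0]) => [|g]; last first.
    by rewrite big_ord0; apply/esym/eqP/ffunP => i; rewrite !thinmx0.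
  rewrite -prodrXl; apply: ler_prod => i _; rewrite sqr_ge0 ffunE /=.
  by rewrite (big_pred1 0) ?big_ord0 ?mul1r // => t; apply/esym/eqP/thinmx0.
pose h (v : 'rV[A]_n.+1) := (v 0 0, \row_j v 0 (lift ord0 j)).
have hbij : bijective h.
  exists (fun u : A * 'rV[A]_n => \row_j oapp (u.2 0) u.1 (unlift ord0 j)).
    by move=> v; apply/rowP => j; rewrite mxE; case: unliftP => [l|] -> //=; rewrite mxE.
  move=> [x u]; rewrite /h mxE unlift_none; congr pair.
  by apply/rowP => j; rewrite !mxE liftK.
have w0 (t : 'rV[A]_n) : 0 <= \prod_(j < n) Q ^+ (t 0 j != 0).
  by apply: prodr_ge0 => j _; apply: exprn_ge0.
have := multilinear_bound_reindex hbij
  (multilinear_bound_prod w0 (@multilinear_bound_coord R A k q hq) IHn).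
move=> bound a a0; have := bound a a0.
rewrite [X in X ^+ 2 <= _ -> _](eq_bigl (fun g : {ffun 'I_k -> 'rV[A]_n.+1} =>
   \big[andb/true]_(j < n.+1) (#|[set i | g i 0 j != 0]| != 1))); last first.
  move=> g; rewrite big_ord_recl /=; congr andb.
    by congr (_ != _); apply: eq_card => i; rewrite !inE !ffunE.
  apply: eq_bigr => j _.
  by congr (_ != _); apply: eq_card => i; rewrite !inE !ffunE mxE.
move=> /le_trans; apply; apply: ler_prod => i _; rewrite sumr_ge0 /=; last first.
  by move=> t _; rewrite !mulr_ge0 ?sqr_ge0 // exprn_ge0.
apply: ler_sum => t _; rewrite big_ord_recl ler_wpM2r ?sqr_ge0 //.
rewrite le_eqVlt; apply/predU1P; left; congr (_ * _).
by apply: eq_bigr => j _; rewrite mxE.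
Qed.

(** * Tuples of frequencies annihilating arithmetic progressions *)

(** The tuples whose characters, evaluated along [X_i = i X + Y], multiply to 1: the first condition
    comes from [Y], the second from [X]. *)
Definition ap_dual (p n k : nat) : pred {ffun 'I_k -> Zpn p n} :=
  fun g => (\sum_i g i == 0) && (\sum_(i < k) g i *+ i.+1 == 0).

(* A relation among the vectors (1, i) involves at least three of them, any two
   being linearly independent for 1 <= i <= k <= p. *)
Lemma card_support_gt2 (p k : nat) (w : 'I_k -> 'F_p) (i0 : 'I_k) :
  prime p -> (k <= p)%N ->
  \sum_i w i = 0 -> \sum_(i < k) w i *+ i.+1 = 0 -> w i0 != 0 ->
  (2 < #|[set i | w i != 0%R]|)%N.
Proof.
move=> p_prime le_kp w0 w1 wi0.
have third i1 : i1 != i0 -> exists2 i2, (i2 != i0) && (i2 != i1) & w i2 != 0.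
  move=> i10; have [i2|none] := pickP (fun i2 => [&& i2 != i0, i2 != i1 & w i2 != 0]).
    by case/and3P=> h1 h2 h3; exists i2 => //; rewrite h1 h2.
  (* Subtracting [i1.+1] times the first relation from the second removes [w i1]. Without a third
     nonzero entry only [w i0 * (i0 - i1)] would remain, and [i0], [i1] are distinct residues
     because [k <= p]. *)
  have : \sum_(i < k) w i * (i%:R - i1%:R) = 0.
    transitivity (\sum_(i < k) (w i *+ i.+1 - w i *+ i1.+1)).
      apply: eq_bigr => i _.
      by rewrite -[w i *+ i.+1]mulr_natr -[w i *+ i1.+1]mulr_natr -!natr1; ring.
    by rewrite sumrB w1 sumrMnl w0 mul0rn subrr.
  rewrite (bigD1 i0) //= big1 ?addr0; last first.
    move=> i ii0; have := none i; rewrite ii0 /=.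
    by case: eqVneq => [->|_ /= /negbFE/eqP ->]; rewrite ?subrr ?mulr0 ?mul0r.
  move/eqP; rewrite mulf_eq0 (negPf wi0) subr_eq0 => /eqP/(congr1 val) /=.
  rewrite !val_Fp_nat ?modn_small ?(leq_trans (ltn_ord _)) // => e.
  by rewrite eq_sym -(inj_eq val_inj) /= e eqxx in i10.
have [i1 i10 wi1] : exists2 i1, i1 != i0 & w i1 != 0.
  have [i1 /andP[]|none] := pickP (fun i1 => (i1 != i0) && (w i1 != 0)).
    by exists i1.
  move: w0; rewrite (bigD1 i0) //= big1 => [|i ii0].
    by rewrite addr0 => e; rewrite e eqxx in wi0.
  by apply/eqP; have := none i; rewrite ii0 => /negbFE.
have [i2 /andP[i20 i21] wi2] := third i1 i10.
apply/card_gt2P; exists i0, i1, i2; split; rewrite ?inE //.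
by split => //; rewrite eq_sym.
Qed.

Lemma ap_dual_support_gt2 (p n k : nat) (g : {ffun 'I_k -> Zpn p n}) i0 j :
  prime p -> (k <= p)%N -> ap_dual g -> g i0 0 j != 0 ->
  (2 < #|[set i | g i 0%R j != 0%R]|)%N.
Proof.
move=> p_prime le_kp /andP[/eqP g0 /eqP g1].
apply: (@card_support_gt2 p k (fun i => g i 0 j) i0) => //.
  by have := congr1 (fun v : Zpn p n => v 0 j) g0; rewrite summxE [RHS]mxE.
have := congr1 (fun v : Zpn p n => v 0 j) g1; rewrite summxE [RHS]mxE.
by under eq_bigr do rewrite mulmxnE.
Qed.

(* As [g i0] is minus the sum of the other [g i], it may be replaced by 0 while
   [b i0] is replaced by the indicator of 0. *)
Lemma ap_dual_sum_le (R : rcfType) (p n k d : nat) (b : 'I_k -> Zpn p n -> R)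
    (i0 : 'I_k) (delta : R) :
  prime p -> (3 <= k <= p)%N ->
  (forall i s, 0 <= b i s) ->
  (forall i, \sum_s b i s ^+ 2 <= 1) ->
  (forall i s, (d < #|supp s|)%N -> b i s = 0) ->
  (forall s, b i0 s <= delta) ->
  \sum_(g | ap_dual g) \prod_(i < k) b i (g i)
    <= delta * (k%:R * Num.sqrt (p%:R - 1)) ^+ (3 * d * k).
Proof.
move=> p_prime /andP[k3 le_kp] b0 b2 bdeg bdelta.
have delta0 : 0 <= delta by apply: le_trans (bdelta 0).
pose b' i (s : Zpn p n) : R := if i == i0 then (s == 0)%:R else b i s.
pose h (g : {ffun 'I_k -> Zpn p n}) : {ffun 'I_k -> Zpn p n} :=
  [ffun i => if i == i0 then 0 else g i].
pose good (g : {ffun 'I_k -> Zpn p n}) :=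
  \big[andb/true]_(j < n) (#|[set i | g i 0 j != 0]| != 1).
have b'0 i s : 0 <= b' i s by rewrite /b'; case: ifP => // _; apply: ler0n.
have hinj : {in [pred g | ap_dual g] &, injective h}.
  move=> g g' /andP[/eqP g0 _] /andP[/eqP g0' _] /ffunP e.
  have e' i : i != i0 -> g i = g' i.
    by move=> ii0; have := e i; rewrite !ffunE (negPf ii0).
  apply/ffunP => i; case: (eqVneq i i0) => [->|]; last exact: e'.
  move: g0 g0'; rewrite (bigD1 i0) //= (eq_bigr _ e') => g0.
  by rewrite (bigD1 i0) //= => g0'; apply: addIr (etrans g0 (esym g0')).
(* At each coordinate the support is empty or has at least three indices; removing [i0] leaves none
   or at least two. *)
have hgood g : ap_dual g -> good (h g).
  move=> dg; rewrite /good big_andE; apply/forallP => j /=.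
  case: (pickP (fun i => g i 0 j != 0)) => [i1 gi1|none].
    have := ap_dual_support_gt2 p_prime le_kp dg gi1.
    rewrite (cardsD1 i0) => lt2.
    have -> : [set i | h g i 0 j != 0] = [set i | g i 0 j != 0] :\ i0.
      by apply/setP => i; rewrite !inE ffunE; case: (i == i0); rewrite //= mxE eqxx.
    by apply/eqP => c1; rewrite c1 in lt2; case: (_ \in _) lt2.
  rewrite (_ : [set _ | _] = set0) ?cards0 //; apply/setP => i.
  by rewrite !inE ffunE; case: ifP => _; rewrite ?mxE ?eqxx // none.
set M := _ ^+ _.
have le1 : \sum_(g | ap_dual g) \prod_(i < k) b i (g i)
    <= delta * \sum_(g | good g) \prod_(i < k) b' i (g i).
  apply: (@le_trans _ _ (delta * \sum_(g | ap_dual g) \prod_(i < k) b' i (h g i))).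
    rewrite mulr_sumr; apply: ler_sum => g _.
    rewrite (bigD1 i0) //= [X in _ <= delta * X](bigD1 i0) //=.
    rewrite /b' ffunE eqxx eqxx mul1r.
    apply: ler_pM => //; first exact: prodr_ge0.
    rewrite le_eqVlt; apply/predU1P; left; apply: eq_bigr => i /negPf ii0.
    by rewrite ffunE ii0.
  (* By injectivity the sum runs over the image of [h], which lies in [good]. *)
  rewrite ler_wpM2l // -(big_imset (fun g : {ffun 'I_k -> Zpn p n} =>
    \prod_(i < k) b' i (g i)) hinj) /=.
  rewrite big_mkcond [leRHS]big_mkcond /=; apply: ler_sum => g _.
  case: imsetP => [[g' dg' ->]|_]; first by rewrite hgood.
  by case: ifP => // _; apply: prodr_ge0.
apply: le_trans le1 _; rewrite ler_wpM2l //.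
pose K : R := k%:R; pose P : R := p%:R - 1.
have K3 : 3 <= K by rewrite ler_nat.
have P1 : 1 <= P.
  by rewrite lerBrDr (_ : 1 + 1 = 2%:R) ?ler_nat ?prime_gt1.
(* [q] is chosen so that [q * P = Q] is a power of [K ^+ 2 * P]; the product of [k] factors [Q ^+ d]
   is then [M ^+ 2], whence the exponent [3 * d * k]. *)
pose q := K ^+ 6 * P ^+ 2; pose Q := (K ^+ 2 * P) ^+ 3.
have hq : 2 * k%:R + 2 * (2 + k%:R) ^+ 2 <= q.
  rewrite -/K /q.
  apply: (@le_trans _ _ (K ^+ 6)).
    2: by rewrite ler_peMr ?exprn_ege1 // exprn_ge0; lra.
  have -> : K ^+ 6 = K ^+ 2 * (K ^+ 2 * K ^+ 2) by ring.
  have K2 : 9 <= K ^+ 2 by nra.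
  have K4 : 81 <= K ^+ 2 * K ^+ 2 by move: K2; set u := K ^+ 2; nra.
  have : 81 * K ^+ 2 <= K ^+ 2 * (K ^+ 2 * K ^+ 2).
    by rewrite mulrC ler_wpM2l ?sqr_ge0.
  by nra.
have Q1 : 1 <= Q by rewrite exprn_ege1 //; nra.
have QE : q * (#|'F_p|%:R - 1) = Q by rewrite card_Fp // -/P /q /Q; ring.
have := @multilinear_bound_row R 'F_p k n q hq b' b'0.
rewrite -/(good) QE => bound.
have M0 : 0 <= M by rewrite exprn_ge0 // mulr_ge0 ?sqrtr_ge0.
rewrite -(@ler_pXn2r _ 2) ?nnegrE //; last by apply: sumr_ge0 => g _; apply: prodr_ge0.
apply: le_trans bound _.
have -> : M ^+ 2 = \prod_(i < k) Q ^+ d.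
  have KP : (k%:R * Num.sqrt (p%:R - 1)) ^+ 2 = K ^+ 2 * P.
    by rewrite exprMn sqr_sqrtr // -/P; lra.
  by rewrite prodr_const card_ord /M /Q -!exprM mulnC exprM KP mulnA.
apply: ler_prod => i _; apply/andP; split.
  apply: sumr_ge0 => s _; rewrite mulr_ge0 ?sqr_ge0 // prodr_ge0 // => j _.
  by rewrite exprn_ge0 //; lra.
have WE (s : Zpn p n) : \prod_(j < n) Q ^+ (s 0 j != 0) = Q ^+ #|supp s|.
  rewrite -prodr_const [RHS]big_mkcond; apply: eq_bigr => j _.
  by rewrite inE; case: (s 0 j == 0).
under eq_bigr do rewrite WE.
(* At [i0] only [s = 0] counts, with weight 1; at the other indices the degree bound keeps the
   weight at most [Q ^+ d]. *)
rewrite /b'; case: (i == i0).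
  rewrite (bigD1 0) //= big1 ?addr0 => [|s /negPf ->]; last by rewrite expr0n mulr0.
  have -> : supp (0 : Zpn p n) = set0 by apply/setP => j; rewrite !inE mxE eqxx.
  by rewrite cards0 eqxx expr1n mulr1 exprn_ege1.
apply: (@le_trans _ _ (\sum_s Q ^+ d * b i s ^+ 2)).
  apply: ler_sum => s _; case: (leqP #|supp s| d) => [le_d|lt_d].
    by rewrite ler_wpM2r ?sqr_ge0 // ler_weXn2l.
  by rewrite bdeg // expr0n !mulr0.
by rewrite -mulr_sumr ler_piMr // exprn_ge0 //; lra.
Qed.

(** * Characters and Fourier expansion *)

Lemma expiD (R : realType) (x y : R) : expi (x + y) = expi x * expi y.
Proof. by rewrite /expi cosD sinD; simpc; rewrite [sin x * _ + _]addrC. Qed.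

Lemma expiMn (R : realType) (x : R) m : expi (x *+ m) = expi x ^+ m.
Proof.
elim: m => [|m IHm]; first by rewrite mulr0n expr0 /expi cos0 sin0.
by rewrite mulrS exprS expiD IHm.
Qed.

Lemma normc_cabs (R : rcfType) (z : R[i]) : `|z| = (cabs z)%:C.
Proof. by case: z. Qed.

(* [fourier] uses [Num.conj], which is selected here by the scope %R; under
   complex_scope the same notation would denote [conjc]. *)
Lemma sqr_cabs (R : rcfType) (z : R[i]) : (cabs z ^+ 2)%:C = z * (z^*)%R.
Proof. by rewrite -normCK normc_cabs rmorphXn. Qed.

Lemma expi_mulJ (R : realType) (x : R) : expi x * ((expi x)^*)%R = 1.
Proof. by rewrite -sqr_cabs /= cos2Dsin2 sqrtr1 expr1n. Qed.

Section Characters.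
Variables (R : realType) (p n : nat).
Hypothesis p_prime : prime p.
Hypothesis p_gt2 : (2 < p)%N.
Implicit Types (s t x y : Zpn p n) (f : Zpn p n -> R[i]).

Local Notation chi := (chi R).

Let zeta : R[i] := expi (2 * pi / p%:R).
Let dot s x : 'F_p := \sum_j s 0 j * x 0 j.

Let p_neq0 : p%:R != 0 :> R.
Proof. by rewrite pnatr_eq0 -lt0n prime_gt0. Qed.

Let zetaXp : zeta ^+ p = 1.
Proof.
rewrite -expiMn -[(_ / _) *+ p]mulr_natr mulfVK // mulr_natl.
by rewrite /expi cos2pi sin2pi.
Qed.

Let zeta_nat m : zeta ^+ m = zeta ^+ (m%:R : 'F_p).
Proof. by rewrite val_Fp_nat // expr_mod. Qed.

Let zetaD (a b : 'F_p) : zeta ^+ (a + b)%R = zeta ^+ a * zeta ^+ b.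
Proof. by rewrite -exprD [RHS]zeta_nat natrD !natr_Zp. Qed.

(** The imaginary part is sin(2 pi / p), positive since 0 < 2 pi / p < pi. *)
Let zeta_neq1 : zeta != 1.
Proof.
rewrite /zeta /expi eq_complex /= negb_and; apply/orP; right.
rewrite gt_eqF // sin_gt0_pi // divr_gt0 ?mulr_gt0 ?pi_gt0 ?ltr0n ?prime_gt0 //=.
by rewrite ltr_pdivrMr ?ltr0n ?prime_gt0 // mulrC ltr_pM2l ?pi_gt0 // ltr_nat.
Qed.

(** The exponent, computed in nat, matters only modulo [p]; in this form [chi] is visibly symmetric
    and bilinear. *)
Let chi_dot s x : chi s x = zeta ^+ dot s x.
Proof.
have -> : dot s x = (\sum_(j < n) (s 0%R j : nat) * (x 0%R j : nat))%N%:R.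
  by rewrite natr_sum; apply: eq_bigr => j _; rewrite natrM !natr_Zp.
by rewrite -zeta_nat -expiMn -[(_ / _) *+ _]mulr_natr mulrAC.
Qed.

Lemma chiC s x : chi s x = chi x s.
Proof.
rewrite !chi_dot; congr (zeta ^+ nat_of_ord _).
by apply: eq_bigr => j _; apply: mulrC.
Qed.

Lemma chiD s x y : chi s (x + y) = chi s x * chi s y.
Proof.
rewrite !chi_dot -zetaD; congr (zeta ^+ nat_of_ord _).
by rewrite -big_split; apply: eq_bigr => j _; rewrite mxE mulrDr.
Qed.

Lemma chi0 s : chi s 0 = 1.
Proof.
rewrite chi_dot (_ : dot s 0 = 0) ?expr0 //.
by apply: big1 => j _; rewrite mxE mulr0.
Qed.

Lemma chi_sum (I : Type) (r : seq I) s (x : I -> Zpn p n) :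
  chi s (\sum_(i <- r) x i) = \prod_(i <- r) chi s (x i).
Proof. exact: (big_morph _ (chiD s) (chi0 s)). Qed.

Lemma chiMn s x m : chi s (x *+ m) = chi (s *+ m) x.
Proof.
rewrite [RHS]chiC; elim: m => [|m IHm]; first by rewrite !mulr0n !chi0.
by rewrite !mulrS !chiD IHm chiC.
Qed.

Lemma chiJ s x : ((chi s x)^*)%R = chi s (- x).
Proof.
have h : chi s x * ((chi s x)^*)%R = 1 by apply: expi_mulJ.
have hN : chi s x * chi s (- x) = 1 :> R[i] by rewrite -chiD subrr chi0.
have chi_neq0 : chi s x != 0 :> R[i].
  by apply/eqP => e; move/eqP: hN; rewrite e mul0r eq_sym oner_eq0.
by apply: (mulfI chi_neq0); rewrite h hN.
Qed.

(** For [s != 0], translating by a [y] with [dot s y = 1] multiplies the sum by [zeta], which is not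
    1. *)
Lemma sum_chi s : \sum_x chi s x = #|{: Zpn p n}|%:R * (s == 0)%:R.
Proof.
have [->|s0] := eqVneq s 0.
  by rewrite mulr1 -sumr_const; apply: eq_bigr => x _; rewrite chiC chi0.
have /rV0Pn[j sj] := s0.
pose y : Zpn p n := \row_i if i == j then (s 0 j)^-1 else 0.
have chi_y : chi s y = zeta.
  have dot1 : dot s y = 1%:R.
    rewrite /dot (bigD1 j) //= big1 => [|i /negPf ij]; rewrite mxE ?ij ?mulr0 //.
    by rewrite eqxx divff ?addr0.
  by rewrite chi_dot dot1 -zeta_nat expr1.
have : \sum_x chi s x = zeta * \sum_x chi s x.
  rewrite [LHS](reindex_inj (addrI y)) /= mulr_sumr.
  by apply: eq_bigr => x _; rewrite chiD chi_y.
move/eqP; rewrite -subr_eq0 -{1}[\sum_x chi s x]mul1r -mulrBl mulf_eq0 subr_eq0.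
by rewrite eq_sym (negPf zeta_neq1) mulr0 => /eqP.
Qed.

Let card_neq0 : #|{: Zpn p n}|%:R != 0 :> R[i].
Proof. by rewrite pnatr_eq0 -lt0n; apply/card_gt0P; exists 0. Qed.

Lemma fourier_inversion f x : f x = \sum_s fourier f s * chi s x.
Proof.
transitivity (\sum_y f y * (\sum_s chi (x - y) s) / #|{: Zpn p n}|%:R).
  under eq_bigr do rewrite sum_chi.
  rewrite (bigD1 x) //= big1 => [|y /negPf yx].
    by rewrite subrr eqxx mulr1 addr0 mulfK.
  by rewrite subr_eq0 eq_sym yx !mulr0 mul0r.
under [RHS]eq_bigr do rewrite /fourier /expect mulrAC mulr_suml mulr_suml.
rewrite [RHS]exchange_big; apply: eq_bigr => y _ /=.
rewrite mulr_sumr mulr_suml; apply: eq_bigr => s _.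
by rewrite chiJ chiC chiD; ring.
Qed.

Lemma parseval f :
  \sum_s cabs (fourier f s) ^+ 2 = expect (fun x => cabs (f x) ^+ 2).
Proof.
apply: (@complexI R); rewrite rmorph_sum /=.
rewrite /expect fmorph_div rmorph_nat rmorph_sum /=.
transitivity (\sum_s fourier f s *
  (\sum_x ((f x)^*)%R * chi s x / #|{: Zpn p n}|%:R)).
  apply: eq_bigr => s _; rewrite sqr_cabs; congr (_ * _).
  rewrite /fourier /expect fmorph_div rmorph_nat rmorph_sum mulr_suml.
  by apply: eq_bigr => x _; rewrite rmorphM /= conjCK.
under [LHS]eq_bigr do rewrite mulr_sumr.
rewrite exchange_big mulr_suml; apply: eq_bigr => x _ /=.
rewrite sqr_cabs {2}(fourier_inversion f x) !mulr_suml.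
by apply: eq_bigr => s _; ring.
Qed.

(** Expanding each [f i] in characters and averaging over [X] and [Y] separately keeps exactly the
    tuples in [ap_dual]; the zero tuple gives the product of the means. *)
Lemma expect_ap_iid k (f : 'I_k -> Zpn p n -> R[i]) :
  expect_ap f - expect_iid f =
  \sum_(g | ap_dual g && (g != 0)) \prod_(i < k) fourier (f i) (g i).
Proof.
have -> : expect_iid f = \prod_(i < k) fourier (f i) 0.
  rewrite /expect_iid /expect card_ffun natrX -bigA_distr_bigA.
  rewrite -prodr_const -prodf_div.
  apply: eq_bigr => i _; rewrite /fourier /expect; congr (_ / _).
  by apply: eq_bigr => x _; rewrite chiC chi0 conjC1 mulr1.
suff -> : expect_ap f = \sum_(g | ap_dual g) \prod_(i < k) fourier (f i) (g i).
  rewrite (bigD1 (0 : {ffun 'I_k -> Zpn p n})) /=; last first.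
    by rewrite /ap_dual !big1 ?eqxx // => i _; rewrite ffunE ?mul0rn.
  rewrite addrAC [X in X - _](eq_bigr (fun i => fourier (f i) 0)) => [|i _].
    by rewrite subrr add0r.
  by rewrite ffunE.
rewrite /expect_ap /expect card_prod natrM.
transitivity (\sum_(g : {ffun 'I_k -> Zpn p n}) \prod_(i < k) fourier (f i) (g i) *
   ((\sum_x chi (\sum_(i < k) g i *+ i.+1) x) * (\sum_y chi (\sum_i g i) y))
    / (#|{: Zpn p n}|%:R * #|{: Zpn p n}|%:R)); last first.
  rewrite [RHS]big_mkcond; apply: eq_bigr => g _; rewrite /ap_dual !sum_chi.
  case: (\sum_i g i == 0); case: (_ == 0);
    rewrite ?mulr0 ?mul0r ?mulr0 ?mul0r ?mulr1 //=.
  by rewrite mulfK // mulf_neq0.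
rewrite -mulr_suml; congr (_ / _).
rewrite (eq_bigr (fun xy : Zpn p n * Zpn p n => \sum_(g : {ffun 'I_k -> Zpn p n})
   \prod_(i < k) fourier (f i) (g i) *
   (chi (\sum_(i < k) g i *+ i.+1) xy.1 * chi (\sum_i g i) xy.2))); last first.
  move=> [x y] _ /=.
  under eq_bigr do rewrite fourier_inversion.
  rewrite bigA_distr_bigA; apply: eq_bigr => g _.
  rewrite big_split; congr (_ * _).
  rewrite [chi _ x]chiC [chi _ y]chiC !chi_sum -big_split.
  by apply: eq_bigr => i _; rewrite chiD chiMn !(chiC (g i *+ _)) (chiC (g i)).
rewrite exchange_big; apply: eq_bigr => g _ /=.
rewrite -mulr_sumr; congr (_ * _).
by rewrite big_distrlr /= pair_bigA.
Qed.

End Characters.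

(** * Moduli of sums, increasing triples of indices, and the two conclusions *)

Lemma cabs_ge0 (R : rcfType) (z : R[i]) : 0 <= cabs z.
Proof. by case: z => a b; apply: sqrtr_ge0. Qed.

Lemma cabs_sum_prod_le (R : rcfType) (I J : finType) (P : pred I)
    (F : I -> J -> R[i]) :
  cabs (\sum_(i | P i) \prod_j F i j) <= \sum_(i | P i) \prod_j cabs (F i j).
Proof.
rewrite -lecR -normc_cabs rmorph_sum /=.
apply: le_trans (ler_norm_sum _ _ _) _.
apply: ler_sum => i _; rewrite normr_prod rmorph_prod /=.
by under eq_bigr do rewrite normc_cabs.
Qed.

(** The enumeration of [A] is increasing, and its first three entries serve. *)
Lemma card_gt2_increasing (k : nat) (A : {set 'I_k}) :
  (2 < #|A|)%N ->
  exists2 i : 'I_3 -> 'I_k,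
    (forall a b : 'I_3, (a < b)%N -> (i a < i b)%N) & (forall a, i a \in A).
Proof.
move=> A3; have lt_size (a : 'I_3) : (a < size (enum A))%N.
  by rewrite -cardE; apply: leq_trans A3.
have [x0 _] : exists x, x \in A by apply/card_gt0P; apply: ltn_trans A3.
exists (fun a => nth x0 (enum A) a) => [a b ab|a]; last first.
  by rewrite -mem_enum mem_nth.
have sorted_A : sorted (relpre val ltn) (enum A).
  rewrite -sorted_map /enum_mem.
  apply: (subseq_sorted ltn_trans (map_subseq _ (filter_subseq _ _))).
  by rewrite -enumT val_enum_ord iota_ltn_sorted.
by apply: (sorted_ltn_nth _ _ sorted_A); rewrite ?inE ?lt_size // => x y z; apply: ltn_trans.
Qed.

Theorem proposition4p2 (R : realType) (p n k d : nat)
    (hp : prime p) (hk : (3 <= k <= p)%N)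
    (f : 'I_k -> Zpn p n -> R[i])
    (hdeg : forall i, fourier_degree_le d (f i))
    (hnorm : forall i, norm2 (f i) <= 1)
    (eps : R) (heps : 0 < eps)
    (hdiff : eps < cabs (expect_ap f - expect_iid f)) :
  let M : R := (k%:R * Num.sqrt (p%:R - 1)) ^+ (3 * d * k) in
  (forall i, ~ delta_uniform (eps / M) (f i)) /\
  (exists (i : 'I_3 -> 'I_k) (s : 'I_3 -> Zpn p n),
    [/\ (forall a b : 'I_3, (a < b)%N -> (i a < i b)%N),
        \bigcap_(j < 3) supp (s j) != set0
      & forall j : 'I_3,
          (eps / (k%:R * M)) ^+ (2 ^ k) <= cabs (fourier (f (i j)) (s j))]).
Proof.
move=> M; have /andP[k3 le_kp] := hk.
have p_gt2 : (2 < p)%N := leq_trans k3 le_kp.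
have k_gt0 : 0 < k%:R :> R by rewrite ltr0n; apply: leq_trans k3.
have M0 : 0 < M.
  by rewrite exprn_gt0 // mulr_gt0 // sqrtr_gt0 subr_gt0 ltr1n prime_gt1.
pose b i s := cabs (fourier (f i) s).
have b0 i s : 0 <= b i s by apply: cabs_ge0.
have b2 i : \sum_s b i s ^+ 2 <= 1.
  rewrite parseval //; have := hnorm i; rewrite /norm2 => h.
  rewrite -[leLHS]sqr_sqrtr ?exprn_ile1 ?sqrtr_ge0 //.
  by rewrite divr_ge0 // sumr_ge0 // => x _; apply: sqr_ge0.
have bdeg i s : (d < #|supp s|)%N -> b i s = 0.
  by move=> /hdeg; rewrite /b => ->; rewrite /= expr0n /= addr0 sqrtr0.
have b1 i s : b i s <= 1.
  rewrite -(@ler_pXn2r _ 2) ?nnegrE // expr1n; apply: le_trans (b2 i).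
  by rewrite (bigD1 s) //= lerDl sumr_ge0 // => t _; apply: sqr_ge0.
have lt_sum : eps < \sum_(g | ap_dual g && (g != 0)) \prod_(i < k) b i (g i).
  by apply: lt_le_trans hdiff _; rewrite expect_ap_iid //; apply: cabs_sum_prod_le.
have sum_le (c : 'I_k -> Zpn p n -> R) : (forall i s, 0 <= c i s) ->
    \sum_(g | ap_dual g && (g != 0)) \prod_(i < k) c i (g i)
      <= \sum_(g | ap_dual g) \prod_(i < k) c i (g i).
  move=> c0; rewrite [leRHS](bigID (fun g => g != 0)) /= lerDl.
  by apply: sumr_ge0 => g _; apply: prodr_ge0.
(* With [delta = eps / M] the bound equals [eps], against [lt_sum]. *)
split=> [i unif|].
  have := ap_dual_sum_le hp hk b0 b2 bdeg unif.
  rewrite divfK ?gt_eqF // => h.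
  by have := lt_le_trans lt_sum (le_trans (sum_le b b0) h); rewrite ltxx.
set tau := eps / (k%:R * M).
have tau0 : 0 <= tau by rewrite divr_ge0 ?ltW // mulr_gt0.
(* All coefficients are at most 1, so the bound with [delta = 1] gives [eps < M]. Thus the threshold
   [tau] implies the weaker one [tau ^+ (2 ^ k)]. *)
have tau1 : tau <= 1.
  have := b1 (Ordinal (leq_trans (isT : 0 < 3)%N k3)).
  move=> /(ap_dual_sum_le hp hk b0 b2 bdeg) h.
  rewrite ler_pdivrMr ?mulr_gt0 // mul1r.
  apply: le_trans (ltW (lt_le_trans lt_sum (le_trans (sum_le b b0) h))) _.
  by rewrite ler_pM2r // ler1n; apply: leq_trans k3.
have tauX : tau ^+ (2 ^ k) <= tau.
  by rewrite -[leRHS]expr1 ler_wiXn2l // expn_gt0.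
have [g /and3P[dg g0 /forallP big_b]|small] :=
    pickP (fun g => [&& ap_dual g, g != 0 & [forall i, tau <= b i (g i)]]).
  have [i0 [j gij]] : exists i0 j, g i0 0 j != 0.
    have [[i0 j]|none] := pickP (fun ij => g ij.1 0 ij.2 != 0); first by exists i0, j.
    case/eqP: g0; apply/ffunP => i; apply/rowP => j; rewrite ffunE mxE.
    by have /negbFE/eqP := none (i, j).
  have [i i_mono iA] := card_gt2_increasing (ap_dual_support_gt2 hp le_kp dg gij).
  exists i, (fun a => g (i a)); split=> // [|a].
    apply/set0Pn; exists j; apply/bigcapP => a _.
    by have := iA a; rewrite !inE.
  exact: le_trans tauX (big_b _).
(* [c i0] deletes the values at least [tau] at index [i0] only. A tuple with [b i0 (g i0) < tau]
   keeps its product in the sum for [i0], where the bound applies with [delta = tau]. *)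
pose c (i0 i : 'I_k) s := if (i == i0) && (tau <= b i s) then 0 else b i s.
have c0 i0 i s : 0 <= c i0 i s by rewrite /c; case: ifP.
have cb i0 i s : c i0 i s <= b i s by rewrite /c; case: ifP.
have : \sum_(g | ap_dual g && (g != 0)) \prod_(i < k) b i (g i)
    <= \sum_i0 \sum_(g | ap_dual g) \prod_(i < k) c i0 i (g i).
  apply: (@le_trans _ _ (\sum_i0 \sum_(g | ap_dual g && (g != 0))
    \prod_(i < k) c i0 i (g i))).
    rewrite exchange_big; apply: ler_sum => g /andP[dg g0] /=.
    have := small g; rewrite dg g0 /= => /negbT.
    rewrite negb_forall => /existsP[i0 lt_b].
    rewrite [leRHS](bigD1 i0) //= -[leLHS]addr0; apply: lerD; last first.
      by apply: sumr_ge0 => i _; apply: prodr_ge0.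
    rewrite le_eqVlt; apply/predU1P; left; apply: eq_bigr => i _.
    by rewrite /c; case: eqP => [->|//]; rewrite (negPf lt_b).
  by apply: ler_sum => i0 _; apply: sum_le.
move=> /(lt_le_trans lt_sum).
suff le_eps : \sum_i0 \sum_(g | ap_dual g) \prod_(i < k) c i0 i (g i) <= eps.
  by move=> /lt_le_trans/(_ le_eps); rewrite ltxx.
have -> : eps = \sum_(i0 < k) tau * M.
  rewrite sumr_const card_ord -[RHS]mulr_natl /tau; field.
  by rewrite !gt_eqF.
apply: ler_sum => i0 _; apply: (ap_dual_sum_le (i0 := i0) hp hk (c0 i0)) => [i|i s lt_d|s].
- apply: le_trans (b2 i); apply: ler_sum => s _.
  by rewrite lerXn2r ?nnegrE.
- by apply/eqP; rewrite eq_le c0 andbT -(bdeg i s lt_d) cb.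
- by rewrite /c eqxx; case: (leP tau) => // /ltW.
Qed.
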